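(* Consider, for each $n$, the Bayesian working model with exponential priors on the error variances described in the context, with slowly varying function $L$ nondecreasing and satisfying $0<L(u)\le M<\infty$, and with Bayes estimators $\hat\theta_i=\mathbb{E}(1-\kappa_i\mid X_i)X_i$ computed with global parameter $\tau=\tau_n$. Let the data be generated as $X_i\sim N(\theta_{0i},\sigma_{0i}^2)$ independently, $i=1,\dots,n$, with $(\theta_{01},\dots,\theta_{0n})\in L_0(q_n)$. Assume (i) $\max_{1\le i\le n}\sigma_{0i}^2=O(1)$, (ii) $q_n=o(n)$, and additionally $\max_{1\le i\le n}|\theta_{0i}|=O(1)$. Choose $\tau_n=(q_n/n)^{1+\epsilon_n}\log(n/q_n)$, where $\epsilon_n\to0$ as $n\to\infty$, and let $M_n\to\infty$. Then $$\lim_{n\to\infty}\ \sup_{(\theta_{01},\dots,\theta_{0n})\in L_0(q_n)}\ \sum_{i=1}^n\mathbb{P}_{0i}\big[(\hat\theta_i-\theta_{0i})^2>M_n\,q_n\log(n/q_n)\big]=0,$$ where the supremum is over vectors in $L_0(q_n)$ satisfying the bound $\max_{1\le i\le n}|\theta_{0i}|=O(1)$ (i.e. $\max_{1\le i\le n}|\theta_{0i}|\le B$ for a fixed constant $B$ not depending on $n$).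
   Context: Working model (for given $n$ and $\tau>0$): (i) $X_i\mid\theta_i,\sigma_i^2\sim N(\theta_i,\sigma_i^2)$ independently, $i=1,\dots,n$; (ii) $\theta_i\mid\sigma_i^2,\lambda_i^2,\tau^2\sim N(0,\sigma_i^2\lambda_i^2\tau^2)$ independently; (iii) $\lambda_1^2,\dots,\lambda_n^2,\sigma_1^2,\dots,\sigma_n^2$ are mutually independent, each $\lambda_i^2$ having the proper prior density $\Pi(\lambda_i^2)=K(\lambda_i^2)^{-a-1}L(\lambda_i^2)$ on $(0,\infty)$, with $a>0$, $K>0$ the normalizing constant, and $L$ a slowly varying function (at infinity); (iv) each $\sigma_i^2$ has prior density $\Pi(\sigma_i^2)=\tfrac12\exp(-\sigma_i^2/2)$ on $(0,\infty)$. Standing assumption on $L$: it is nondecreasing and $0<L(u)\le M<\infty$ for all $u>0$. The shrinkage factor is $\kappa_i=(1+\lambda_i^2\tau^2)^{-1}$, and $\mathbb{E}(\cdot\mid X_i)$ denotes posterior expectation given $X_i$ under the working model. $q_n$ is a sequence of positive numbers, and $L_0(q_n)=\{(\theta_{01},\dots,\theta_{0n})\in\mathbb{R}^n:\sum_{i=1}^n I_{[\theta_{0i}\ne0]}\le q_n\}$. The true means $\theta_{0i}$ and true variances $\sigma_{0i}^2>0$ are fixed, and $\mathbb{P}_{0i}$ denotes probability when $X_i\sim N(\theta_{0i},\sigma_{0i}^2)$.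
   Formalization: When a ≤ 1/4, q_n is additionally assumed to be eventually bounded below by a positive constant; for arbitrary positive q_n the claim fails, e.g. a=1/10, L(u)=min(u,1), q_n=1/n, ε_n=0, M_n=log n, σ_{0i}=1. *)

(* Defs.v *)
From HB Require Import structures.
From mathcomp Require Export all_boot all_order all_algebra.
From mathcomp Require Export all_classical all_reals all_analysis.
Export Order.TTheory GRing.Theory Num.Theory.
Export numFieldNormedType.Exports.

Set Implicit Arguments.
Unset Strict Implicit.
Unset Printing Implicit Defensive.

Global Open Scope classical_set_scope.
Global Open Scope ring_scope.

(* [normal_pdf] and [normal_prob] take a standard deviation as second
   parameter; these two take a variance.  All variances below are positive
   whenever [tau <> 0], so the library's convention at deviation 0 is never
   used. *)
Definition gauss_pdf (R : realType) (m v x : R) : R :=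
  normal_pdf m (Num.sqrt v) x.

Definition gauss_prob (R : realType) (m v : R) (A : set R) : \bar R :=
  normal_prob m (Num.sqrt v) A.

Definition slowly_varying (R : realType) (L : R -> R) : Prop :=
  forall c : R, 0 < c -> (L (c * x) / L x) @[x --> +oo] --> (1 : R).

(* Prior density of the squared local parameter, u = lambda_i^2, meant on
   ]0, +oo[. *)
Definition local_prior (R : realType) (a K : R) (L : R -> R) (u : R) : R :=
  K * u `^ (- a - 1) * L u.

(* Joint density of (X_i, theta_i, lambda_i^2, sigma_i^2) at (x, t, u, s). *)
Definition joint_density (R : realType) (a K : R) (L : R -> R) (tau : R)
    (x t u s : R) : R :=
  gauss_pdf t s x * gauss_pdf 0 (s * u * tau ^+ 2) t
  * local_prior a K L u * exponential_pdf 2^-1 s.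

(* Posterior expectation of g (theta_i, lambda_i^2, sigma_i^2) given X_i = x,
   by Bayes' formula.  Under the working model the n coordinates are
   independent and identically distributed, so this does not depend on i. *)
Definition posterior_mean (R : realType) (a K : R) (L : R -> R) (tau : R)
    (g : R -> R -> R -> R) (x : R) : R :=
  fine (\int[lebesgue_measure]_(s in `]0%R, +oo[)
        \int[lebesgue_measure]_(u in `]0%R, +oo[)
        \int[lebesgue_measure]_t
          (g t u s * joint_density a K L tau x t u s)%:E)%E
  / fine (\int[lebesgue_measure]_(s in `]0%R, +oo[)
          \int[lebesgue_measure]_(u in `]0%R, +oo[)
          \int[lebesgue_measure]_t
            (joint_density a K L tau x t u s)%:E)%E.

Definition shrinkage (R : realType) (tau u : R) : R := (1 + u * tau ^+ 2)^-1.

Definition bayes_estimator (R : realType) (a K : R) (L : R -> R) (tau : R)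
    (x : R) : R :=
  posterior_mean a K L tau (fun _ u _ => 1 - shrinkage tau u) x * x.

Definition nearly_black (R : realType) (n : nat) (q : R) : set ('I_n -> R) :=
  [set theta | \sum_(i < n) (theta i != 0)%:R <= q].

(* Main.v *)
Require Import Defs.
From mathcomp Require Import measurable_realfun ring lra.

(** For [theta_i <> 0] (at most [q_n] indices) the estimator shrinks [X_i]
    towards 0, so the squared error is at most [4 (X_i - theta_i)^2 + 6 B^2] and
    a Gaussian tail bound gives a total of order [1 / (M_n log (n / q_n))].

    For [theta_i = 0] there are two regimes.  If [a <= 1/4] then [q_n] is bounded
    below, [q_n log (n / q_n)] is at least of order [log n], and
    [|hat theta_i| <= |X_i|] already gives [P = O(1 / (n M_n))].  If [1/4 < a],
    choose [1/4 < b < a] with [b <= 1].  In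
    [E(1 - kappa | X) = numerator / denominator] the numerator is
    [O(tau^(2b))], because [1 - kappa <= (u tau^2)^b] and the prior has a finite
    moment of order [b]; the denominator is at least [c exp(- x^2 / s0)] with
    [s0] as large as we like, obtained from the values [s >= s0] of the error
    variance.  Taking [s0 = 12 S], where [S] bounds the true variances, makes
    [(E(1 - kappa | X) X)^2] integrable, and Markov's inequality gives
    [P = O(tau^(4b) / (M_n q_n log (n / q_n))) = O(1 / (n M_n))]. *)

Set Implicit Arguments.
Unset Strict Implicit.
Unset Printing Implicit Defensive.

(** * Integrals without measurability, Gaussian densities *)

(* Unlike [ge0_le_integral], no measurability is assumed: the integral of a
   nonnegative function is the supremum over the simple functions below it.
   Hence neither the marginals of the joint density nor the events defined by
   the estimator need to be shown measurable. *)
Lemma le_integral_pointwise d (T : measurableType d) (R : realType)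
    (mu : {measure set T -> \bar R}) (D : set T) (f g : T -> \bar R) :
  (forall x, D x -> (0 <= f x <= g x)%E) ->
  (\int[mu]_(x in D) f x <= \int[mu]_(x in D) g x)%E.
Proof.
move=> fg; rewrite [leLHS]integral_mkcond [leRHS]integral_mkcond.
have f0 x : (0 <= (f \_ D) x)%E.
  by apply: erestrict_ge0 => y /fg/andP[].
have le x : ((f \_ D) x <= (g \_ D) x)%E.
  by apply: lee_restrict => y /fg/andP[].
rewrite !ge0_integralTE//; last by move=> x; exact: le_trans (f0 x) (le x).
apply: ereal_sup_le => _ [h /= hf <-]; exists h => // x.
exact: le_trans (hf x) (le x).
Qed.

(** The interval [[p, p + 1]] has measure 1, so the constant passes unchanged; two uses, in [s] and
    in [u], bound the denominator of the posterior mean from below. *)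
Lemma le_integral_pos_itv (R : realType) (p c : R) (f : R -> \bar R) :
  0 < p -> 0 <= c ->
  (forall x : R, 0 < x -> (0 <= f x)%E) ->
  (forall x : R, p <= x <= p + 1 -> (c%:E <= f x)%E) ->
  (c%:E <= \int[lebesgue_measure]_(x in `]0%R, +oo[) f x)%E.
Proof.
move=> p0 c0 f0 fc.
pose I : set R := `[p, p + 1]%classic; pose g : R -> \bar R := (cst c%:E) \_ I.
have -> : (c%:E = \int[lebesgue_measure]_(x in `]0%R, +oo[) g x)%E.
  rewrite -integral_mkcondr integral_cst//=.
  rewrite (_ : _ `&` _ = I); last first.
    apply/seteqP; split => x; rewrite /I /= !in_itv/= ?andbT; first by case.
    by move=> xp; split => //; lra.
  rewrite lebesgue_measure_itv/= lte_fin ltrDl ltr01 -EFinB addrAC subrr add0r.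
  by rewrite mule1.
  by apply: measurableI => //; exact: measurable_itv.
apply: le_integral_pointwise => x /=; rewrite in_itv/= andbT => x0.
rewrite /g patchE; case: ifPn => [|_]; last by rewrite lexx/= f0.
by rewrite inE /I /= in_itv/= => px; rewrite lee_fin c0 fc.
Qed.

Lemma gauss_pdfE (R : realType) (m v x : R) : 0 < v ->
  gauss_pdf m v x = (Num.sqrt (v * pi *+ 2))^-1 * expR (- (x - m) ^+ 2 / (v *+ 2)).
Proof.
move=> v0; rewrite /gauss_pdf normal_pdfE ?gt_eqF ?sqrtr_gt0//.
by rewrite /normal_peak /normal_fun sqr_sqrtr// ltW.
Qed.

Lemma gauss_pdf_ge0 (R : realType) (m v x : R) : 0 <= gauss_pdf m v x.
Proof. exact: normal_pdf_ge0. Qed.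

Lemma integral_gauss_pdf (R : realType) (m v : R) :
  (\int[lebesgue_measure]_x (gauss_pdf m v x)%:E = 1)%E.
Proof. exact: integral_normal_pdf. Qed.

Lemma measurable_gauss_pdf (R : realType) (m v : R) :
  measurable_fun [set: R] (gauss_pdf m v).
Proof. exact: measurable_normal_pdf. Qed.

Lemma integralZ_gauss_pdf (R : realType) (c m v : R) : 0 <= c ->
  (\int[lebesgue_measure]_x (c * gauss_pdf m v x)%:E = c%:E)%E.
Proof.
move=> c0; under eq_integral do rewrite EFinM.
rewrite ge0_integralZl_EFin//; last 2 first.
- by move=> x _; rewrite lee_fin gauss_pdf_ge0.
- by apply/measurable_EFinP; exact: measurable_gauss_pdf.
by rewrite integral_gauss_pdf mule1.
Qed.

(** The exponential adds [2 c] to the precision [1 / v], and the square root is the ratio of the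
    normalizing constants. The sign of [c] is free: tail bounds take [c < 0], the denominator bound
    takes [c > 0]. *)
Lemma gauss_pdf_tilt (R : realType) (c m v x : R) : 0 < v -> 0 < 1 + 2 * c * v ->
  expR (- c * (x - m) ^+ 2) * gauss_pdf m v x =
  (Num.sqrt (1 + 2 * c * v))^-1 * gauss_pdf m (v / (1 + 2 * c * v)) x.
Proof.
move=> v0 cv0; have vcv0 : 0 < v / (1 + 2 * c * v) by rewrite divr_gt0.
rewrite !gauss_pdfE// mulrCA -expRD mulrA -invfM -sqrtrM 1?ltW//.
congr ((Num.sqrt _)^-1 * expR _).
  by field; rewrite gt_eqF.
by field; rewrite !gt_eqF.
Qed.

(* Tilting by [exp((x - m)^2 / (4 v))] doubles the variance, which costs the
   factor [sqrt 2]. *)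
Lemma gauss_prob_le (R : realType) (m v c : R) (A : set R) : 0 < v -> 0 <= c ->
  (forall x, A x -> 1 <= c * expR ((x - m) ^+ 2 / (4 * v))) ->
  (gauss_prob m v A <= (c * Num.sqrt 2)%:E)%E.
Proof.
move=> v0 c0 Ac; rewrite /gauss_prob /normal_prob.
have cs0 : 0 <= c * Num.sqrt 2 by rewrite mulr_ge0.
rewrite -(integralZ_gauss_pdf m (2 * v) cs0) integral_mkcond.
apply: le_integral_pointwise => x _; rewrite patchE; case: ifPn => [|_]; last first.
  by rewrite lexx lee_fin mulr_ge0// gauss_pdf_ge0.
rewrite inE => /Ac cx; rewrite lee_fin normal_pdf_ge0/= lee_fin.
have e12 : 1 + 2 * - (4 * v)^-1 * v = 2^-1 by field; rewrite gt_eqF.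
have := @gauss_pdf_tilt R (- (4 * v)^-1) m v x v0.
rewrite e12 sqrtrV// !invrK opprK mulrC (mulrC v) => tilt.
rewrite -mulrA -tilt ?invr_gt0// mulrCA ler_peMr ?gauss_pdf_ge0//.
by rewrite (mulrC _^-1).
Qed.

(** * Moments of the priors *)

(* Only boundedness of the antiderivative [F] is needed: [f] is integrated over
   the segments [[a + 1 / (n + 2), a + n + 2]]. *)
Lemma integral_itv_oy_le (R : realType) (f F : R -> R) (a l : R) :
  (forall x, a < x -> 0 <= f x) ->
  (forall x, a < x -> {for x, continuous f}) ->
  (forall x, a < x -> is_derive x 1 F (f x)) ->
  (forall x, a < x -> 0 <= F x <= l) ->
  (\int[lebesgue_measure]_(x in `]a, +oo[) (f x)%:E <= l%:E)%E.
Proof.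
move=> f0 cf dF Fl.
pose I (n : nat) : set R := `[a + n.+2%:R^-1, a + n.+2%:R]%classic.
have n2 (n : nat) : 0 < (n.+2%:R : R)^-1 < n.+2%:R.
  rewrite invr_gt0 ltr0n/= invf_plt ?posrE ?ltr0n//.
  by rewrite (@lt_trans _ _ 1)// ?invf_lt1 ?ltr0n// ltr1n.
have Ia n x : I n x -> a < x.
  rewrite /I/= in_itv/= => /andP[+ _]; apply: lt_le_trans.
  by rewrite ltrDl; have /andP[] := n2 n.
have mf n : measurable_fun (I n) (EFin \o f).
  apply/measurable_EFinP; apply: (@measurable_funS _ _ _ _ `]a, +oo[%classic) => //.
    by move=> x /Ia; rewrite /= in_itv/= andbT.
  apply: open_continuous_measurable_fun => //.
  by move=> x; rewrite inE/= in_itv/= andbT => /cf.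
have -> : `]a, +oo[%classic = \bigcup_n I n.
  apply/seteqP; split => [x|x [n _ /Ia]]; rewrite /= in_itv/= andbT// => ax.
  have [n _ nx] : \forall n \near \oo, (n%:R : R) > x - a by exact: nbhs_infty_gtr.
  have [m _ mx] : \forall n \near \oo, (n%:R : R) > (x - a)^-1 by exact: nbhs_infty_gtr.
  exists (maxn n m) => //; rewrite /I/= in_itv/=.
  have xa : 0 < x - a by rewrite subr_gt0.
  have Nn : x - a < (maxn n m).+2%:R.
    by apply: nx; rewrite /= (leq_trans (leq_maxl n m))// -addn2 leq_addr.
  have Nm : (x - a)^-1 < (maxn n m).+2%:R.
    by apply: mx; rewrite /= (leq_trans (leq_maxr n m))// -addn2 leq_addr.
  have Nx : (maxn n m).+2%:R^-1 <= x - a.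
    by rewrite invf_ple ?posrE ?ltr0n// ltW.
  by rewrite -lerBrDl Nx -lerBlDl ltW.
have cvgI : (\int[lebesgue_measure]_(x in I n) (f x)%:E)%E @[n --> \oo] -->
    (\int[lebesgue_measure]_(x in \bigcup_n I n) (f x)%:E)%E.
  apply: ge0_nondecreasing_set_cvg_integral => //.
  - apply/nondecreasing_seqP => n; apply/subsetPset => x.
    rewrite /I/= !in_itv/= => /andP[x1 x2]; apply/andP; split.
      by rewrite (le_trans _ x1)// lerD2l lef_pV2 ?posrE ?ltr0n// ler_nat.
    by rewrite (le_trans x2)// lerD2l ler_nat.
  - by move=> n; exact: measurable_itv.
  - by move=> n x /Ia ax; rewrite lee_fin f0.
rewrite -(cvg_lim _ cvgI)//; apply: lime_le.
  by apply/cvg_ex; eexists; exact: cvgI.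
apply: nearW => n; have /andP[n0 nn] := n2 n.
rewrite (@continuous_FTC2 _ f F)//.
- rewrite -EFinB lee_fin.
  have := Fl (a + n.+2%:R); have := Fl (a + n.+2%:R^-1).
  rewrite !ltrDl n0 (lt_trans n0 nn) => /(_ isT)/andP[F1 F2] /(_ isT)/andP[F3 F4].
  lra.
- by rewrite ltrD2l.
- by apply: continuous_in_subspaceT => x; rewrite inE => /Ia /cf.
- have ax x : x \in `](a + n.+2%:R^-1), (a + n.+2%:R)[ -> a < x.
    by rewrite in_itv/= => /andP[+ _]; apply: lt_trans; rewrite ltrDl.
  split.
  + by move=> x /ax /dF[].
  + apply: cvg_at_right_filter; apply: differentiable_continuous.
    by apply/derivable1_diffP; have [] := dF (a + n.+2%:R^-1); rewrite // ltrDl.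
  + apply: cvg_at_left_filter; apply: differentiable_continuous.
    apply/derivable1_diffP; have [] := dF (a + n.+2%:R); rewrite // ltrDl.
    exact: lt_trans nn.
- move=> x; rewrite in_itv/= => /andP[xa _].
  have /dF dx : a < x by rewrite (lt_trans _ xa)// ltrDl.
  by rewrite derive1E derive_val.
Qed.

(** An antiderivative is [2 atan (sqrt s)], with values in [[0, pi]]. This integrand dominates the
    contribution of the error variance to the numerator. *)
Lemma integral_inv_sqrtM1D (R : realType) :
  (\int[lebesgue_measure]_(s in `]0%R, +oo[)
     ((Num.sqrt s * (1 + s))^-1)%:E <= (pi : R)%:E)%E.
Proof.
apply: (@integral_itv_oy_le _ _ (fun s => 2 * atan (Num.sqrt s))) => x x0.
- by rewrite invr_ge0 mulr_ge0// addr_ge0// ltW.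
- apply: cvgV; first by rewrite mulf_neq0 ?gt_eqF ?sqrtr_gt0 ?addr_gt0.
  apply: cvgM; first exact: sqrt_continuous.
  by apply: cvgD; [exact: cvg_cst|exact: cvg_id].
- have d1 : is_derive x 1 (@atan R \o Num.sqrt)
      ((1 + Num.sqrt x ^+ 2)^-1 * (2 * Num.sqrt x)^-1).
    by apply: is_derive1_comp; exact: is_derive1_sqrt.
  have := @is_deriveZ _ _ _ _ 2 _ _ _ d1.
  rewrite sqr_sqrtr ?ltW// => d2; apply: is_derive_eq d2 _.
  rewrite /GRing.scale/=; field.
  by rewrite !gt_eqF ?sqrtr_gt0// addr_gt0.
- have a0 : 0 <= atan (Num.sqrt x).
    by rewrite -(atan0 R); apply: le_atan; rewrite sqrtr_ge0.
  have := atan_ltpi2 (Num.sqrt x); lra.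
Qed.

Lemma integral_powR_tail (R : realType) (d : R) : 0 < d ->
  (\int[lebesgue_measure]_(u in `]1%R, +oo[) (u `^ (- d - 1))%:E <= d^-1%:E)%E.
Proof.
(* The additive constant [d^-1] keeps the antiderivative in [[0, d^-1]] for [u > 1]. *)
move=> d0; apply: (@integral_itv_oy_le _ _ (fun u => d^-1 - d^-1 * u `^ (- d))).
- by move=> x _; exact: powR_ge0.
- move=> x x1; apply: differentiable_continuous; apply/derivable1_diffP.
  by have [] := @is_derive1_powR _ (- d - 1) x (lt_trans ltr01 x1).
- move=> x x1; have xd := @is_derive1_powR _ (- d) x (lt_trans ltr01 x1).
  have := @is_deriveB _ _ _ _ _ _ _ _ _ (is_derive_cst (d^-1 : R) x 1)
    (@is_deriveZ _ _ _ _ d^-1 _ _ _ xd).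
  move=> H; apply: is_derive_eq H _.
  by rewrite /GRing.scale/=; field; rewrite gt_eqF.
- move=> x x1; have xd0 := powR_ge0 x (- d).
  have xd1 : x `^ (- d) <= 1.
    by rewrite -(powRr0 x) ler_powR ?ltW// oppr_lt0.
  have di : 0 < d^-1 by rewrite invr_gt0.
  nra.
Qed.

Lemma measurable_local_prior (R : realType) (a K : R) (L : R -> R) :
  (forall u v : R, 0 < u -> u <= v -> L u <= L v) ->
  (forall u : R, 0 < u -> 0 < L u) ->
  measurable_fun (`]0, +oo[%classic : set R) (local_prior a K L).
Proof.
move=> Lnd L0; apply: measurable_funM.
  by apply: measurable_funM => //; apply: measurable_funTS; exact: measurable_powR.
(* Extended by 0, [L] stays nondecreasing on the whole line because it is positive on []0, +oo[]. *)
apply: (eq_measurable_fun (fun u : R => if 0 < u then L u else 0)).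
  by move=> u; rewrite inE/= in_itv/= andbT => ->.
apply: nondecreasing_measurable => // u v uv.
case: ifPn => u0; first by rewrite (lt_le_trans u0 uv) Lnd.
by case: ifPn => // v0; rewrite ltW// L0.
Qed.

Lemma local_prior_gt0 (R : realType) (a K : R) (L : R -> R) (u : R) :
  0 < K -> 0 < L u -> 0 < u -> 0 < local_prior a K L u.
Proof. by move=> K0 L0 u0; rewrite !mulr_gt0// powR_gt0. Qed.

(** For [u <= 1] the factor [u^b] is at most 1 and the prior is proper; for [u > 1] the bound
    [L <= M] leaves [K M u^(- (a - b) - 1)], integrable since [b < a]. *)
Lemma local_prior_moment (R : realType) (a b K M : R) (L : R -> R) :
  0 < b < a -> 0 < K ->
  (forall u v : R, 0 < u -> u <= v -> L u <= L v) ->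
  (forall u : R, 0 < u -> 0 < L u <= M) ->
  (\int[lebesgue_measure]_(u in `]0%R, +oo[) (local_prior a K L u)%:E = 1)%E ->
  exists2 H : R, 0 <= H &
    (\int[lebesgue_measure]_(u in `]0%R, +oo[)
       (u `^ b * local_prior a K L u)%:E <= H%:E)%E.
Proof.
move=> /andP[b0 ba] K0 Lnd LM proper.
have L0 u : 0 < u -> 0 < L u by move=> /LM/andP[].
have M0 : 0 <= M by have /andP[? ?] := LM 1 ltr01; lra.
have KM : 0 <= K * M by rewrite mulr_ge0// ltW.
have ab0 : 0 < a - b by rewrite subr_gt0.
pose J : set R := `]1, +oo[%classic.
pose g (u : R) : \bar R := (K * M * u `^ (- (a - b) - 1))%:E.
have g0 u : (0 <= g u)%E by rewrite lee_fin mulr_ge0// powR_ge0.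
have mg D : measurable_fun D g.
  apply/measurable_EFinP; apply: measurable_funM => //.
  by apply: measurable_funTS; exact: measurable_powR.
exists (1 + K * M * (a - b)^-1).
  by rewrite addr_ge0// mulr_ge0// invr_ge0 ltW.
apply: (@le_trans _ _ (\int[lebesgue_measure]_(u in `]0%R, +oo[)
    ((local_prior a K L u)%:E + (g \_ J) u))%E).
  apply: le_integral_pointwise => u; rewrite /= in_itv/= andbT => u0.
  have p0 := local_prior_gt0 a K0 (L0 _ u0) u0.
  rewrite lee_fin mulr_ge0 ?powR_ge0 ?(ltW p0)//=.
  rewrite /J patchE; case: ifPn; rewrite ?notin_setE ?inE /= in_itv/= andbT => u1.
    rewrite -EFinD lee_fin -[leLHS]add0r lerD ?(ltW p0)//.
    rewrite /local_prior mulrA mulrCA -powRD; last first.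
      by apply/implyP => _; rewrite gt_eqF.
    rewrite (_ : b + (- a - 1) = - (a - b) - 1); last by ring.
    rewrite mulrAC ler_wpM2r ?powR_ge0// ler_wpM2l ?(ltW K0)//.
    by have /andP[] := LM u u0.
  rewrite adde0 lee_fin ler_piMl ?(ltW p0)//.
  have {}u1 : u <= 1 by rewrite leNgt; apply/negP.
  by rewrite -(powRr0 u) ger_powR ?u0// ltW.
rewrite ge0_integralD//=; last 4 first.
- move=> u; rewrite in_itv/= andbT => u0.
  by rewrite lee_fin ltW// local_prior_gt0// L0.
- by apply/measurable_EFinP; exact: measurable_local_prior.
- by move=> u _; apply: erestrict_ge0.
- apply: measurable_funTS; apply/(measurable_restrictT _ _).1; last exact: mg.
  exact: measurable_itv.
rewrite proper EFinD leeD2l// -integral_mkcondr.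
rewrite (_ : _ `&` J = J); last first.
  apply/setIidPr => u; rewrite /J/= !in_itv/= !andbT; exact: lt_trans.
rewrite /g; under eq_integral do rewrite EFinM.
rewrite ge0_integralZl_EFin//; last 2 first.
- by move=> u _; rewrite lee_fin powR_ge0.
- apply/measurable_EFinP; apply: measurable_funTS; exact: measurable_powR.
  rewrite [leRHS]EFinM; apply: lee_wpmul2l; first by rewrite lee_fin.
  exact: integral_powR_tail.
exact: measurable_itv.
Qed.

(** * The posterior mean of [1 - kappa] *)

Lemma fine_ratio_itv01 (R : realType) (N D : \bar R) :
  (0 <= N)%E -> (N <= D)%E -> 0 <= fine N / fine D <= 1.
Proof.
case: N => [n| |] //; case: D => [d| |] //=; rewrite ?lee_fin ?mul0r ?invr0 ?mulr0 ?lexx ?ler01//.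
move=> n0 nd; have [d0|d0] := leP d 0.
  by rewrite (_ : d = 0) ?invr0 ?mulr0 ?lexx ?ler01//; lra.
by rewrite divr_ge0 ?(ltW d0)//= ler_pdivrMr// mul1r.
Qed.

(* If [D] is infinite then [fine D = 0] and the ratio is 0. *)
Lemma fine_ratio_le (R : realType) (N D : \bar R) (n d : R) :
  (0 <= N)%E -> (N <= n%:E)%E -> 0 < d -> (d%:E <= D)%E ->
  fine N / fine D <= n / d.
Proof.
move=> N0 Nn d0; have n0 : 0 <= n by rewrite -lee_fin (le_trans N0).
case: N N0 Nn => [r| |] //=; rewrite !lee_fin => r0 rn.
case: D => [e| |] //=; last by rewrite invr0 mulr0 divr_ge0// ltW.
rewrite lee_fin => de; apply: ler_pM => //.
  by rewrite invr_ge0 (le_trans (ltW d0)).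
by rewrite lef_pV2 ?posrE// (lt_le_trans d0).
Qed.

Lemma exponential_pdf2_ge0 (R : realType) (s : R) : 0 <= exponential_pdf 2^-1 s.
Proof. by apply: exponential_pdf_ge0; rewrite invr_ge0. Qed.

Lemma joint_density_ge0 (R : realType) (a K : R) (L : R -> R) (tau x t u s : R) :
  0 < K -> (forall u : R, 0 < u -> 0 < L u) -> 0 < u ->
  0 <= joint_density a K L tau x t u s.
Proof.
move=> K0 L0 u0; have /ltW p0 := local_prior_gt0 a K0 (L0 _ u0) u0.
rewrite /joint_density; move: (local_prior _ _ _ _) p0 => p p0.
by rewrite !mulr_ge0 ?gauss_pdf_ge0 ?exponential_pdf2_ge0.
Qed.

Lemma shrinkage_itv01 (R : realType) (tau u : R) : 0 < u ->
  0 <= 1 - shrinkage tau u <= 1.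
Proof.
move=> u0; have y0 : 0 <= u * tau ^+ 2 by rewrite mulr_ge0 ?sqr_ge0// ltW.
rewrite /shrinkage subr_ge0 lerBlDr lerDl invr_ge0 addr_ge0// andbT.
by rewrite invf_le1 ?lerDl// ltr_wpDr.
Qed.

(** With [y = u tau^2], one has [1 - kappa = y / (1 + y) <= min(y, 1) <= y^b] for [0 < b <= 1]. *)
Lemma onem_shrinkage_le (R : realType) (tau u b : R) : 0 < tau -> 0 < u ->
  0 < b <= 1 -> 1 - shrinkage tau u <= (tau ^+ 2) `^ b * u `^ b.
Proof.
move=> tau0 u0 /andP[b0 b1]; have y0 : 0 < u * tau ^+ 2 by rewrite mulr_gt0 ?exprn_gt0.
rewrite -powRM ?sqr_ge0 ?(ltW u0)// mulrC; move: y0 (shrinkage_itv01 tau u0).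
rewrite /shrinkage; set y := u * _ => y0 /andP[k0 k1].
have [y1|y1] := leP y 1.
  apply: (@le_trans _ _ y); last by rewrite ger1_powR// y0.
  rewrite (_ : 1 - _ = y / (1 + y)); last by field; rewrite gt_eqF// ltr_wpDl.
  by rewrite ler_pdivrMr ?ltr_wpDl// ler_peMr ?ltW// ltrDl.
by rewrite (le_trans k1)// -(powRr0 y) ler_powR// ltW.
Qed.

Lemma posterior_shrinkage_itv01 (R : realType) (a K : R) (L : R -> R) (tau x : R) :
  0 < K -> (forall u : R, 0 < u -> 0 < L u) ->
  0 <= posterior_mean a K L tau (fun _ u _ => 1 - shrinkage tau u) x <= 1.
Proof.
move=> K0 L0.
have J0 t u s : 0 < u -> 0 <= joint_density a K L tau x t u s.
  exact: joint_density_ge0.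
have I0 u s : 0 < u -> (0 <= \int[lebesgue_measure]_t
    ((1 - shrinkage tau u) * joint_density a K L tau x t u s)%:E)%E.
  move=> u0; apply: integral_ge0 => t _; rewrite lee_fin mulr_ge0 ?J0//.
  by have /andP[] := shrinkage_itv01 tau u0.
apply: fine_ratio_itv01.
  apply: integral_ge0 => s _; apply: integral_ge0 => u /=.
  by rewrite in_itv/= andbT; exact: I0.
apply: le_integral_pointwise => s _; apply/andP; split.
  by apply: integral_ge0 => u /=; rewrite in_itv/= andbT; exact: I0.
apply: le_integral_pointwise => u /=; rewrite in_itv/= andbT => u0.
rewrite I0//=; apply: le_integral_pointwise => t _.
have /andP[k0 k1] := shrinkage_itv01 tau u0.
by rewrite !lee_fin mulr_ge0 ?J0//= ler_piMl ?J0.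
Qed.

(** The left side is the peak of the likelihood times the prior of [s]; [1 + s / 2 <= exp(s / 2)]
    turns it into the integrand of [integral_inv_sqrtM1D]. *)
Lemma inv_sqrt_exponential_pdf_le (R : realType) (s : R) : 0 < s ->
  (Num.sqrt (s * pi *+ 2))^-1 * exponential_pdf 2^-1 s
    <= (Num.sqrt s * (1 + s))^-1.
Proof.
move=> s0; rewrite exponential_pdfE ?(ltW s0)//.
have e0 : 1 + s <= 2 * expR (s / 2).
  by have := expR_ge1Dx (s / 2); lra.
have pi1 : 1 <= (pi : R) *+ 2.
  by have := @pi_ge2 R; rewrite -mulr_natr; lra.
have sq : Num.sqrt s <= Num.sqrt (s * pi *+ 2).
  by rewrite ler_wsqrtr// -mulrnAr ler_peMr ?(ltW s0).
have s1 : 0 < 1 + s by rewrite addr_gt0.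
have ss : 0 < Num.sqrt s by rewrite sqrtr_gt0.
rewrite mulNr expRN -invfM -invfM lef_pV2 ?posrE; last 2 first.
- by rewrite !mulr_gt0 ?expR_gt0// (lt_le_trans ss).
- by rewrite mulr_gt0.
apply: ler_pM => //; rewrite ?(ltW ss) ?(ltW s1)//.
by rewrite (mulrC _^-1).
Qed.

(** Bounding the likelihood by its peak removes [x]. Then the prior of [t] integrates to 1, the
    [u]-integral gives [tau^(2b) H], and the [s]-integral gives [pi]. *)
Lemma shrinkage_numerator_le (R : realType) (a K b H : R) (L : R -> R) (tau x : R) :
  0 < K -> (forall u v : R, 0 < u -> u <= v -> L u <= L v) ->
  (forall u : R, 0 < u -> 0 < L u) -> 0 < tau -> 0 < b <= 1 ->
  (\int[lebesgue_measure]_(u in `]0%R, +oo[)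
       (u `^ b * local_prior a K L u)%:E <= H%:E)%E -> 0 <= H ->
  (\int[lebesgue_measure]_(s in `]0%R, +oo[)
        \int[lebesgue_measure]_(u in `]0%R, +oo[)
        \int[lebesgue_measure]_t
          ((1 - shrinkage tau u) * joint_density a K L tau x t u s)%:E
    <= ((tau ^+ 2) `^ b * H * pi)%:E)%E.
Proof.
move=> K0 Lnd L0 tau0 b01 HH H0.
have p0 u : 0 < u -> 0 < local_prior a K L u.
  by move=> u0; apply: local_prior_gt0 => //; exact: L0.
have tb0 : 0 <= (tau ^+ 2) `^ b by exact: powR_ge0.
have mJ (c : R) : 0 <= c -> (\int[lebesgue_measure]_(u in `]0%R, +oo[)
    (c * (u `^ b * local_prior a K L u))%:E <= c%:E * H%:E)%E.
  move=> c0; under eq_integral do rewrite EFinM.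
  rewrite ge0_integralZl_EFin//; last 2 first.
  - move=> u /=; rewrite in_itv/= andbT => u0.
    by rewrite lee_fin mulr_ge0 ?powR_ge0// ltW// p0.
  - apply/measurable_EFinP; apply: measurable_funM.
      by apply: measurable_funTS; exact: measurable_powR.
    exact: measurable_local_prior.
  by apply: lee_wpmul2l; rewrite ?lee_fin.
pose r (s : R) := (Num.sqrt (s * pi *+ 2))^-1 * exponential_pdf 2^-1 s.
have r0 s : 0 <= r s by rewrite mulr_ge0 ?exponential_pdf2_ge0// invr_ge0.
apply: (@le_trans _ _ (\int[lebesgue_measure]_(s in `]0%R, +oo[)
    (((tau ^+ 2) `^ b * H)%:E * ((Num.sqrt s * (1 + s))^-1)%:E))%E); last first.
  rewrite ge0_integralZl_EFin//; last 3 first.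
  - by move=> s /=; rewrite in_itv/= andbT => s0; rewrite lee_fin invr_ge0 mulr_ge0// addr_ge0// ltW.
  - apply/measurable_EFinP; apply: open_continuous_measurable_fun => //.
    move=> s; rewrite inE/= in_itv/= andbT => s0.
    apply: cvgV; first by rewrite mulf_neq0 ?gt_eqF ?sqrtr_gt0 ?addr_gt0.
    apply: cvgM; first exact: sqrt_continuous.
    by apply: cvgD; [exact: cvg_cst|exact: cvg_id].
  - by rewrite mulr_ge0.
  rewrite [leRHS]EFinM; apply: lee_wpmul2l; first by rewrite lee_fin mulr_ge0.
  exact: integral_inv_sqrtM1D.
apply: le_integral_pointwise => s /=; rewrite in_itv/= andbT => s0.
apply/andP; split.
  apply: integral_ge0 => u /=; rewrite in_itv/= andbT => u0.
  apply: integral_ge0 => t _; rewrite lee_fin mulr_ge0 ?joint_density_ge0//.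
  by have /andP[] := shrinkage_itv01 tau u0.
apply: (@le_trans _ _ (((tau ^+ 2) `^ b * r s)%:E * H%:E)%E); last first.
  rewrite -!EFinM lee_fin mulrAC; apply: ler_wpM2l; first by rewrite mulr_ge0.
  exact: inv_sqrt_exponential_pdf_le.
apply: le_trans (mJ _ _); last by rewrite mulr_ge0.
apply: le_integral_pointwise => u /=; rewrite in_itv/= andbT => u0.
have /andP[k0 k1] := shrinkage_itv01 tau u0.
apply/andP; split.
  by apply: integral_ge0 => t _; rewrite lee_fin mulr_ge0 ?joint_density_ge0.
have pu := p0 _ u0.
(* The bound is written as an integral against the Gaussian prior of [t], so that the integrands can
   be compared pointwise. *)
rewrite -(integralZ_gauss_pdf 0 (s * u * tau ^+ 2)); last first.
  by apply: mulr_ge0; [exact: mulr_ge0|apply: mulr_ge0; [exact: powR_ge0|exact: ltW]].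
apply: le_integral_pointwise => t _; rewrite !lee_fin.
rewrite mulr_ge0 ?joint_density_ge0//= /joint_density.
have gE : gauss_pdf t s x <= (Num.sqrt (s * pi *+ 2))^-1.
  rewrite gauss_pdfE// ler_piMr ?invr_ge0// -expR0 ler_expR mulNr oppr_le0.
  by rewrite divr_ge0 ?sqr_ge0// mulrn_wge0// ltW.
have kb := onem_shrinkage_le tau0 u0 b01.
set G := gauss_pdf 0 _ t; have G0 : 0 <= G by exact: gauss_pdf_ge0.
have e0 := exponential_pdf2_ge0 s.
rewrite [leLHS](_ : _ = (1 - shrinkage tau u) * gauss_pdf t s x *
  (local_prior a K L u * exponential_pdf 2^-1 s * G)); last by ring.
rewrite [leRHS](_ : _ = ((tau ^+ 2) `^ b * u `^ b * (Num.sqrt (s * pi *+ 2))^-1) *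
  (local_prior a K L u * exponential_pdf 2^-1 s * G)); last by rewrite /r; ring.
apply: ler_wpM2r.
  by apply: mulr_ge0 => //; apply: mulr_ge0 => //; exact: ltW.
by apply: ler_pM => //; exact: gauss_pdf_ge0.
Qed.

(** On the square [[s0, s0 + 1] x [1, 2]] every factor is bounded below uniformly in [tau <= 1]; the
    dependence on [x] is mild when [s0] is large. *)
Lemma joint_density_mass_ge (R : realType) (a K s0 : R) (L : R -> R) :
  0 < K -> 0 < a -> (forall u v : R, 0 < u -> u <= v -> L u <= L v) ->
  (forall u : R, 0 < u -> 0 < L u) -> 0 < s0 ->
  exists2 c : R, 0 < c & forall tau x u s : R, 0 < tau <= 1 ->
    s0 <= s <= s0 + 1 -> 1 <= u <= 1 + 1 ->
    ((c * expR (- x ^+ 2 / s0))%:E <=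
      \int[lebesgue_measure]_t (joint_density a K L tau x t u s)%:E)%E.
Proof.
move=> K0 a0 Lnd L0 s00; have s10 : 0 < s0 + 1 by rewrite addr_gt0.
(* Worst cases on the square: [c1] for the peak of the likelihood at [s = s0 + 1], [c2] for the
   local prior (power at [u = 2], [L] at [u = 1]), [c3] for the exponential density at [s0 + 1], and
   [c4] for the tilt, as [1 + 2 u tau^2 <= 5]. *)
pose c1 := (Num.sqrt ((s0 + 1) * (pi : R) *+ 2))^-1.
pose c2 := K * (1 + 1) `^ (- a - 1) * L 1.
pose c3 := 2^-1 * expR (- 2^-1 * (s0 + 1)).
pose c4 := (Num.sqrt (5 : R))^-1.
have c10 : 0 < c1 by rewrite invr_gt0 sqrtr_gt0 mulrn_wgt0// mulr_gt0 ?pi_gt0.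
have c20 : 0 < c2 by rewrite !mulr_gt0 ?powR_gt0 ?addr_gt0 ?L0.
have c30 : 0 < c3 by rewrite mulr_gt0 ?expR_gt0// invr_gt0.
have c40 : 0 < c4 by rewrite invr_gt0 sqrtr_gt0.
have c0 : 0 < c1 * c2 * c3 * c4 by do 3!apply: mulr_gt0 => //.
exists (c1 * c2 * c3 * c4) => //.
move=> tau x u s /andP[tau0 tau1] /andP[sl su] /andP[ul uu].
have sgt0 : 0 < s by rewrite (lt_le_trans s00).
have u0 : 0 < u by rewrite (lt_le_trans _ ul).
have v0 : 0 < s * u * tau ^+ 2 by rewrite !mulr_gt0 ?exprn_gt0.
have tau21 : tau ^+ 2 <= 1 by rewrite expr_le1// ltW.
have tau20 : 0 < tau ^+ 2 by rewrite exprn_gt0.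
have e5 : 1 + 2 * s^-1 * (s * u * tau ^+ 2) = 1 + 2 * (u * tau ^+ 2).
  by field; rewrite gt_eqF.
have e50 : 0 < 1 + 2 * s^-1 * (s * u * tau ^+ 2) by rewrite e5; nra.
set C := c1 * _ * _ * _ * _.
have C0 : 0 <= C by apply: mulr_ge0; [exact: ltW|exact: expR_ge0].
rewrite -(integralZ_gauss_pdf 0 (s * u * tau ^+ 2 / (1 + 2 * s^-1 * (s * u * tau ^+ 2))) C0).
apply: le_integral_pointwise => t _; rewrite !lee_fin.
rewrite mulr_ge0 ?gauss_pdf_ge0//=.
(* [(x - t)^2 <= 2 x^2 + 2 t^2]; the factor [exp(- t^2 / s)] is absorbed in the
   Gaussian prior of [t]. *)
have tilt := @gauss_pdf_tilt R s^-1 0 _ t v0 e50.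
set G := gauss_pdf _ (_ / _) t in tilt *; have G0 : 0 <= G by exact: gauss_pdf_ge0.
set B := gauss_pdf _ _ t in tilt; have B0 : 0 <= B by exact: gauss_pdf_ge0.
rewrite subr0 in tilt.
have hA : c1 * expR (- x ^+ 2 / s0) * expR (- s^-1 * t ^+ 2) <= gauss_pdf t s x.
  rewrite gauss_pdfE// -mulrA -expRD; apply: ler_pM; rewrite ?(ltW c10) ?expR_ge0//.
    rewrite lef_pV2 ?posrE ?sqrtr_gt0 ?mulrn_wgt0 ?mulr_gt0 ?pi_gt0//.
    by rewrite ler_wsqrtr// lerMn2r/= ler_wpM2r// pi_ge0.
  rewrite ler_expR.
  have -> : - (x - t) ^+ 2 / (s *+ 2) = - (2^-1 * (x - t) ^+ 2) * s^-1.
    by rewrite -mulr_natr; field; rewrite gt_eqF.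
  have si : s^-1 <= s0^-1 by rewrite lef_pV2.
  have x20 : 0 <= x ^+ 2 by exact: sqr_ge0.
  have sx : x ^+ 2 * s^-1 <= x ^+ 2 * s0^-1 by rewrite ler_wpM2l.
  have si0 : 0 < s^-1 by rewrite invr_gt0.
  have xt : 2^-1 * (x - t) ^+ 2 <= x ^+ 2 + t ^+ 2 by have := sqr_ge0 (x + t); nra.
  have := ler_wpM2r (ltW si0) xt; lra.
have hB : c4 * G <= expR (- s^-1 * t ^+ 2) * B.
  rewrite tilt ler_wpM2r// lef_pV2 ?posrE ?sqrtr_gt0// ler_wsqrtr// e5; nra.
have hC : c2 <= local_prior a K L u.
  apply: ler_pM; rewrite ?(ltW (L0 _ _))// ?mulr_ge0 ?powR_ge0 ?(ltW K0)//; last exact: Lnd.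
  rewrite ler_wpM2l ?(ltW K0)// -(opprD a 1) !powRN lef_pV2 ?posrE ?powR_gt0//.
  by rewrite ge0_ler_powR ?nnegrE ?addr_ge0// ltW.
have hD : c3 <= exponential_pdf 2^-1 s.
  rewrite exponential_pdfE ?(ltW sgt0)// ler_wpM2l ?invr_ge0// ler_expR !mulNr lerN2.
  by rewrite ler_wpM2l ?invr_ge0.
rewrite /joint_density -/B.
have E0 : 0 <= c1 * expR (- x ^+ 2 / s0) * (expR (- s^-1 * t ^+ 2) * B).
  by rewrite mulr_ge0// mulr_ge0 ?expR_ge0// ltW.
apply: (@le_trans _ _ (c1 * expR (- x ^+ 2 / s0) * (expR (- s^-1 * t ^+ 2) * B) * c2 * c3)).
  rewrite [leLHS](_ : _ = (c1 * expR (- x ^+ 2 / s0) * (c4 * G)) * c2 * c3); last by rewrite /C; ring.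
  apply: ler_wpM2r; first exact: ltW.
  apply: ler_wpM2r; first exact: ltW.
  by apply: ler_wpM2l => //; rewrite mulr_ge0 ?expR_ge0 ?(ltW c10).
have p0 : 0 <= local_prior a K L u by exact: le_trans (ltW c20) hC.
apply: ler_pM => //; rewrite ?(ltW c30)//.
  by apply: mulr_ge0; [|exact: ltW].
apply: ler_pM => //; rewrite ?(ltW c20)//.
by rewrite mulrA ler_wpM2r.
Qed.

Lemma posterior_shrinkage_le (R : realType) (a b K M s0 : R) (L : R -> R) :
  0 < b < a -> b <= 1 -> 0 < K -> 0 < s0 ->
  (forall u v : R, 0 < u -> u <= v -> L u <= L v) ->
  (forall u : R, 0 < u -> 0 < L u <= M) ->
  (\int[lebesgue_measure]_(u in `]0%R, +oo[) (local_prior a K L u)%:E = 1)%E ->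
  exists2 C : R, 0 <= C & forall tau x : R, 0 < tau <= 1 ->
    posterior_mean a K L tau (fun _ u _ => 1 - shrinkage tau u) x <=
    C * (tau ^+ 2) `^ b * expR (x ^+ 2 / s0).
Proof.
move=> bab b1 K0 s00 Lnd LM proper.
have /andP[b0 ba] := bab; have a0 := lt_trans b0 ba.
have L0 u : 0 < u -> 0 < L u by move=> /LM/andP[].
have [H H0 HH] := local_prior_moment bab K0 Lnd LM proper.
have [c c0 hc] := joint_density_mass_ge K0 a0 Lnd L0 s00.
exists (H * pi / c); first by rewrite divr_ge0 ?mulr_ge0 ?pi_ge0// ltW.
move=> tau x tau01; have /andP[tau0 tau1] := tau01.
have J0 t u s : 0 < u -> 0 <= joint_density a K L tau x t u s.
  exact: joint_density_ge0.
have d0 : 0 < c * expR (- x ^+ 2 / s0) by rewrite mulr_gt0 ?expR_gt0.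
have b01 : 0 < b <= 1 by rewrite b0.
rewrite [leRHS](_ : _ = (tau ^+ 2) `^ b * H * pi / (c * expR (- x ^+ 2 / s0))); last first.
  by rewrite mulNr expRN; field; rewrite !gt_eqF ?expR_gt0.
apply: fine_ratio_le => //.
- apply: integral_ge0 => s _; apply: integral_ge0 => u /=.
  rewrite in_itv/= andbT => u0; apply: integral_ge0 => t _.
  rewrite lee_fin mulr_ge0 ?J0//.
  by have /andP[] := shrinkage_itv01 tau u0.
- exact: shrinkage_numerator_le.
- apply: (@le_integral_pos_itv _ s0) => //; first exact: ltW.
    move=> s _; apply: integral_ge0 => u /=; rewrite in_itv/= andbT => u0.
    by apply: integral_ge0 => t _; rewrite lee_fin J0.
  move=> s ss; apply: (@le_integral_pos_itv _ 1) => //; first exact: ltW.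
    by move=> u u0; apply: integral_ge0 => t _; rewrite lee_fin J0.
  by move=> u u12; exact: hc.
Qed.

(** * Tail probabilities of the estimator *)

Lemma expR_ge_id (R : realType) (y : R) : y <= expR y.
Proof. by have := expR_ge1Dx y; lra. Qed.

(** On the event, [T <= 4 (x - m)^2 + 6 B^2]. With [y = (x - m)^2 / (4 v)], the square is
    [4 v y <= 4 S exp y], whence [T <= (16 S + 6 B^2) exp y], as [gauss_prob_le] requires. *)
Lemma gauss_prob_shrunk_le (R : realType) (w : R -> R) (m v S B T : R) :
  (forall x, 0 <= w x <= 1) -> 0 < v <= S -> `|m| <= B -> 0 < T ->
  (gauss_prob m v [set x | (T < (w x * x - m) ^+ 2)%R] <=
    ((16 * S + 6 * B ^+ 2) / T * Num.sqrt 2)%:E)%E.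
Proof.
move=> w01 /andP[v0 vS] mB T0; have S0 := lt_le_trans v0 vS.
have c0 : 0 <= 16 * S + 6 * B ^+ 2 by have := sqr_ge0 B; lra.
apply: gauss_prob_le => //; first by rewrite divr_ge0// ltW.
move=> x /= Tx; rewrite mulrAC ler_pdivlMr// mul1r.
have /andP[w0 w1] := w01 x.
have mB2 : m ^+ 2 <= B ^+ 2.
  by rewrite -(real_normK (num_real m)) lerXn2r ?nnegrE// (le_trans _ mB).
have Tle : T <= 4 * (x - m) ^+ 2 + 6 * B ^+ 2.
  have w2 : (w x * x) ^+ 2 <= x ^+ 2.
    by rewrite exprMn ler_piMl ?sqr_ge0// expr_le1.
  have h1 : (w x * x - m) ^+ 2 <= 2 * (w x * x) ^+ 2 + 2 * m ^+ 2.
    by have := sqr_ge0 (w x * x + m); nra.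
  have h2 : x ^+ 2 <= 2 * (x - m) ^+ 2 + 2 * m ^+ 2.
    by have := sqr_ge0 (x - 2 * m); nra.
  lra.
set y := (x - m) ^+ 2 / (4 * v).
have y0 : 0 <= y by rewrite divr_ge0 ?sqr_ge0// mulr_ge0// ltW.
have xy : (x - m) ^+ 2 <= 4 * S * y.
  have -> : (x - m) ^+ 2 = 4 * v * y by rewrite /y; field; rewrite gt_eqF.
  by rewrite ler_wpM2r// ler_wpM2l.
have e1 : 1 <= expR y by rewrite -expR0 ler_expR.
have ey : S * y <= S * expR y by rewrite ler_wpM2l ?(ltW S0)// expR_ge_id.
have eB : B ^+ 2 <= B ^+ 2 * expR y by rewrite ler_peMr ?sqr_ge0.
lra.
Qed.

(** The event forces [x^2 > T], hence [exp(x^2 / (4 v)) >= exp(T / (4 S))]. *)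
Lemma gauss_prob0_shrunk_le_expR (R : realType) (w : R -> R) (v S T : R) :
  (forall x, 0 <= w x <= 1) -> 0 < v <= S -> 0 <= T ->
  (gauss_prob 0 v [set x | (T < (w x * x - 0) ^+ 2)%R] <=
    (expR (- (T / (4 * S))) * Num.sqrt 2)%:E)%E.
Proof.
move=> w01 /andP[v0 vS] T0; have S0 := lt_le_trans v0 vS.
apply: gauss_prob_le => //.
move=> x /=; rewrite !subr0 => Tx; have /andP[w0 w1] := w01 x.
rewrite -expRD -[leLHS]expR0 ler_expR addrC subr_ge0.
have w2 : (w x * x) ^+ 2 <= x ^+ 2 by rewrite exprMn ler_piMl ?sqr_ge0// expr_le1.
apply: ler_pM => //; first by rewrite invr_ge0 mulr_ge0// ltW.
  exact: le_trans (ltW Tx) w2.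
by rewrite lef_pV2 ?posrE ?mulr_gt0// ler_wpM2l.
Qed.

(** With [z = x^2 / (12 S)], the factor [w^2] costs [exp(2 z)] and [x^2 = 12 S z] costs one more
    [exp z]. The total [exp(3 z) = exp(x^2 / (4 S))] is just what [gauss_prob_le] allows, hence the
    12. *)
Lemma gauss_prob0_shrunk_le_sqr (R : realType) (w : R -> R) (r v S T : R) :
  (forall x, 0 <= w x <= r * expR (x ^+ 2 / (12 * S))) -> 0 < v <= S -> 0 < T ->
  (gauss_prob 0 v [set x | (T < (w x * x - 0) ^+ 2)%R] <=
    (12 * S * r ^+ 2 / T * Num.sqrt 2)%:E)%E.
Proof.
move=> wr /andP[v0 vS] T0; have S0 := lt_le_trans v0 vS.
apply: gauss_prob_le => //.
  by rewrite divr_ge0 ?(ltW T0)// mulr_ge0 ?sqr_ge0// mulr_ge0// ltW.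
move=> x /=; rewrite !subr0 => Tx; have /andP[w0 w1] := wr x.
rewrite mulrAC ler_pdivlMr// mul1r (le_trans (ltW Tx))//.
set z := x ^+ 2 / (12 * S); set y := x ^+ 2 / (4 * v).
have zx : x ^+ 2 = 12 * S * z by rewrite /z; field; rewrite gt_eqF.
have zy : 3 * z <= y.
  have -> : 3 * z = x ^+ 2 / (4 * S) by rewrite /z; field; rewrite gt_eqF.
  by rewrite ler_wpM2l ?sqr_ge0// lef_pV2 ?posrE ?mulr_gt0// ler_wpM2l.
have w2 : w x ^+ 2 <= r ^+ 2 * expR z ^+ 2.
  by rewrite -exprMn lerXn2r ?nnegrE// (le_trans w0).
rewrite exprMn; apply: (@le_trans _ _ (r ^+ 2 * expR z ^+ 2 * (12 * S * expR z))).
  apply: ler_pM => //; rewrite ?sqr_ge0// zx ler_wpM2l ?expR_ge_id//.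
  by rewrite mulr_ge0// ltW.
rewrite [leLHS](_ : _ = 12 * S * r ^+ 2 * expR z ^+ 3); last by ring.
rewrite -expRM_natl ler_wpM2l ?ler_expR//.
by rewrite mulr_ge0 ?sqr_ge0// mulr_ge0// ltW.
Qed.

(** * Elementary inequalities for the global parameter and the threshold *)

Lemma ln_le_half (R : realType) (l : R) : 0 < l -> ln l <= l / 2.
Proof.
move=> l0; rewrite -ler_expR lnK ?posrE//.
have -> : l / 2 = (l / 4) *+ 2 by rewrite -mulr_natr; field.
rewrite -mulr_natl expRM_natl.
apply: (@le_trans _ _ ((1 + l / 4) ^+ 2)); first by have := sqr_ge0 (1 - l / 4); nra.
by rewrite lerXn2r ?nnegrE ?expR_ge0 ?expR_ge1Dx//; lra.
Qed.

(** Here [y] is [n / q]. With [l = ln y], [tau = exp(ln l - (1 + e) l)], and both claims compare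
    exponents through [ln l <= l / 2]. The second reduces to [- 4 b e l <= (4 b - 1) l / 2], which
    needs [4 b > 1] and a small [e]. *)
Lemma tau_bounds (R : realType) (y e b : R) :
  0 < y -> 1 <= ln y -> 4^-1 < b -> `|e| <= 2^-1 -> 8 * b * `|e| <= 4 * b - 1 ->
  let tau := y^-1 `^ (1 + e) * ln y in
  0 < tau <= 1 /\ y * ((tau ^+ 2) `^ b) ^+ 2 <= ln y.
Proof.
move=> y0 l1 b4 e2 eb tau; set l := ln y in l1 *.
have l0 : 0 < l by lra.
have tE : tau = expR (ln l - (1 + e) * l).
  rewrite /tau /powR gt_eqF ?invr_gt0// lnV ?posrE// -/l mulrN.
  by rewrite expRD lnK ?posrE// mulrC.
have ll := ln_le_half l0.
have [e1 e3] : - `|e| <= e /\ e <= `|e| by split; [rewrite lerNl ler_normr lexx orbT|exact: ler_norm].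
split.
  have el : 2^-1 * l <= (1 + e) * l by rewrite ler_wpM2r//; lra.
  by rewrite tE expR_gt0 -[leRHS]expR0 ler_expR; lra.
have -> : ((tau ^+ 2) `^ b) ^+ 2 = expR (4 * b * (ln l - (1 + e) * l)).
  rewrite tE -expRM_natl -powR_mulrn ?powR_ge0// -!expRM.
  by congr expR; ring.
rewrite -{1}(lnK y0) -/l -expRD -[leRHS](lnK l0) ler_expR.
have d0 : 0 < 4 * b - 1 by lra.
have h1 := ler_wpM2l (ltW d0) ll.
have h2 : - (4 * b * e * l) <= (4 * b - 1) / 2 * l.
  rewrite -mulNr ler_wpM2r ?(ltW l0)//; nra.
lra.
Qed.

(* Case split at [q = sqrt x]. *)
Lemma sparsity_threshold_ge (R : realType) (x q c : R) :
  0 < c -> c <= q -> 0 < x -> 1 <= ln x -> 1 <= ln (x / q) ->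
  Num.min c 1 / 2 * ln x <= q * ln (x / q).
Proof.
move=> c0 cq x0 lx lxq; have q0 := lt_le_trans c0 cq.
have mc : Num.min c 1 <= c by rewrite ge_min lexx.
have m1 : Num.min c 1 <= 1 by rewrite ge_min lexx orbT.
have m0 : 0 < Num.min c 1 by rewrite lt_min c0 ltr01.
have lE : ln (x / q) = ln x - ln q by rewrite ln_div ?posrE.
have [ql|ql] := leP (ln q) (ln x / 2).
  apply: (@le_trans _ _ (c * (ln x / 2))); last by apply: ler_pM => //; lra.
  by rewrite mulrAC -mulrA ler_wpM2r//; lra.
have qx : ln x / 2 <= q.
  apply: le_trans (expR_ge_id _) _.
  by rewrite -[leRHS](lnK q0) ler_expR ltW.
apply: (@le_trans _ _ (ln x / 2)); last by rewrite (le_trans qx)// ler_peMr// ltW.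
by rewrite mulrAC -mulrA ler_piMl//; lra.
Qed.

(** The left side is at most [exp((1 - k) ln x) <= exp(1 - k)], and [exp(- k) <= 1 / k]. *)
Lemma expR_threshold_le (R : realType) (x r k : R) : 0 < x -> 1 <= ln x ->
  0 < k -> 1 <= k -> k * ln x <= r -> x * expR (- r) <= expR 1 / k.
Proof.
move=> x0 lx k0 k1 kr; rewrite -{1}(lnK x0) -expRD.
apply: (@le_trans _ _ (expR (1 - k))); first by rewrite ler_expR; nra.
by rewrite expRD expRN ler_wpM2l ?expR_ge0// lef_pV2 ?posrE ?expR_gt0// expR_ge_id.
Qed.

(** * Zero means in the two regimes of [a] *)

Lemma zero_mean_tail_gt4V (R : realType) (a K M S : R) (L : R -> R) :
  4^-1 < a -> 0 < K -> 0 < S ->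
  (forall u v : R, 0 < u -> u <= v -> L u <= L v) ->
  (forall u : R, 0 < u -> 0 < L u <= M) ->
  (\int[lebesgue_measure]_(u in `]0%R, +oo[) (local_prior a K L u)%:E = 1)%E ->
  exists C d : R, [/\ 0 <= C, 0 < d & forall x q e m v : R,
    0 < x -> 0 < q -> 1 <= ln (x / q) -> `|e| <= d -> 0 < m -> 0 < v <= S ->
    (gauss_prob 0 v [set z | (m * q * ln (x / q) <
        (bayes_estimator a K L ((q / x) `^ (1 + e) * ln (x / q)) z - 0) ^+ 2)%R]
      <= (C / (x * m))%:E)%E].
Proof.
move=> a4 K0 S0 Lnd LM proper.
have L0 u : 0 < u -> 0 < L u by move=> /LM/andP[].
(* The prior moment needs [b < a], the bound on [1 - kappa] needs [b <= 1], and [tau_bounds] needs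
   [b > 1/4]. *)
have [b [b4 ba b1]] : exists b : R, [/\ 4^-1 < b, b < a & b <= 1].
  have [a1|a1] := leP a 1; last by exists 1; split => //; lra.
  by exists ((a + 4^-1) / 2); split; lra.
have b0 : 0 < b by lra.
have bab : 0 < b < a by rewrite b0.
have s00 : 0 < 12 * S by rewrite mulr_gt0.
have [C C0 hC] := posterior_shrinkage_le bab b1 K0 s00 Lnd LM proper.
have d0 : 0 < (4 * b - 1) / (8 * b) by rewrite divr_gt0 ?mulr_gt0//; lra.
exists (12 * S * C ^+ 2 * Num.sqrt 2), (Num.min 2^-1 ((4 * b - 1) / (8 * b))).
split.
- by rewrite !mulr_ge0 ?sqr_ge0 ?(ltW S0).
- by rewrite lt_min d0 andbT invr_gt0.
move=> x q e m v x0 q0 l1; rewrite le_min => /andP[e2 ed] m0 v0S.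
set l := ln (x / q) in l1 *; have l0 : 0 < l by lra.
have xq0 : 0 < x / q by rewrite divr_gt0.
have eb : 8 * b * `|e| <= 4 * b - 1.
  by rewrite mulrC -ler_pdivlMr// mulr_gt0.
have := tau_bounds xq0 l1 b4 e2 eb; rewrite /= invf_div -/l.
set tau := (q / x) `^ _ * l => -[tau01 tau_b].
have T0 : 0 < m * q * l by rewrite !mulr_gt0.
apply: le_trans (@gauss_prob0_shrunk_le_sqr _
  (fun z => posterior_mean a K L tau (fun _ u _ => 1 - shrinkage tau u) z)
  (C * (tau ^+ 2) `^ b) _ _ _ _ v0S T0) _.
  move=> z; have /andP[-> _] := posterior_shrinkage_itv01 a tau z K0 L0.
  by rewrite hC.
rewrite lee_fin [leRHS]mulrAC ler_wpM2r// exprMn.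
set rho := _ `^ b ^+ 2 in tau_b *.
have rho0 : 0 <= rho by exact: sqr_ge0.
(* The last factor is at most 1 by [tau_bounds] at [y = x / q]; this trades [1 / q] for [1 / x]. *)
have -> : 12 * S * (C ^+ 2 * rho) / (m * q * l) =
    12 * S * C ^+ 2 / (x * m) * ((x / q * rho) / l).
  by field; rewrite !gt_eqF.
apply: ler_piMr; last by rewrite ler_pdivrMr// mul1r.
by apply: divr_ge0; rewrite mulr_ge0 ?sqr_ge0 ?(ltW x0) ?(ltW m0)// mulr_ge0 ?(ltW S0).
Qed.

(** By [sparsity_threshold_ge] the threshold is at least [m k ln x]. Taking [m >= 4 S / k] makes the
    tail exponent at least [ln x], as [expR_threshold_le] requires. *)
Lemma zero_mean_tail_bounded_below (R : realType) (c S : R) :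
  0 < c -> 0 < S ->
  exists C m0 : R, 0 <= C /\ forall (w : R -> R) (x q m v : R),
    (forall z, 0 <= w z <= 1) -> 0 < x -> 1 <= ln x -> c <= q ->
    1 <= ln (x / q) -> m0 <= m -> 0 < m -> 0 < v <= S ->
    (gauss_prob 0 v [set z | (m * q * ln (x / q) < (w z * z - 0) ^+ 2)%R]
      <= (C / (x * m))%:E)%E.
Proof.
move=> c0 S0; pose k := Num.min c 1 / 2.
have k0 : 0 < k by rewrite divr_gt0// lt_min c0 ltr01.
exists (expR 1 * (4 * S / k) * Num.sqrt 2), (4 * S / k); split.
  by rewrite mulr_ge0// mulr_ge0 ?expR_ge0// divr_ge0 ?(ltW k0)// mulr_ge0// ltW.
move=> w x q m v w01 x0 lx cq lxq mm m0 v0S.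
have q0 := lt_le_trans c0 cq.
have T0 : 0 <= m * q * ln (x / q) by rewrite mulr_ge0 ?mulr_ge0 ?(ltW q0) ?(ltW m0)//; lra.
apply: le_trans (gauss_prob0_shrunk_le_expR w01 v0S T0) _.
rewrite lee_fin [leRHS]mulrAC ler_wpM2r//.
have hk := sparsity_threshold_ge c0 cq x0 lx lxq.
have S40 : 0 < 4 * S by rewrite mulr_gt0.
have mk0 : 0 < m * k / (4 * S) by rewrite divr_gt0// mulr_gt0.
have mk1 : 1 <= m * k / (4 * S).
  by rewrite ler_pdivlMr// mul1r -ler_pdivrMr.
have := @expR_threshold_le _ x (m * q * ln (x / q) / (4 * S)) _ x0 lx mk0 mk1.
have -> : m * k / (4 * S) * ln x <= m * q * ln (x / q) / (4 * S).
  rewrite mulrAC ler_wpM2r ?invr_ge0 ?(ltW S40)// -!mulrA ler_wpM2l ?(ltW m0)//.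
  by rewrite mulrA.
move=> /(_ isT); rewrite mulrC -ler_pdivlMr// => /le_trans; apply.
by rewrite le_eqVlt; apply/orP; left; apply/eqP; field; rewrite !gt_eqF.
Qed.

(** * Summation over the coordinates and passage to the limit *)

Lemma sparse_sum_le (R : realType) (n : nat) (theta : 'I_n -> R) (q p1 p0 : R)
    (P : 'I_n -> \bar R) :
  \sum_(i < n) (theta i != 0)%:R <= q -> 0 <= p1 -> 0 <= p0 ->
  (forall i, theta i != 0 -> (P i <= p1%:E)%E) ->
  (forall i, theta i = 0 -> (P i <= p0%:E)%E) ->
  (\sum_(i < n) P i <= (q * p1 + n%:R * p0)%:E)%E.
Proof.
move=> tq p10 p00 P1 P0.
apply: (@le_trans _ _ (\sum_(i < n) ((theta i != 0)%:R * p1 + p0)%:E)%E).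
  apply: lee_sum => i _; have [t0|t0] := eqVneq (theta i) 0.
    by rewrite mul0r add0r P0.
  by rewrite mul1r (le_trans (P1 _ t0))// lee_fin lerDl.
rewrite sumEFin lee_fin big_split/= -mulr_suml sumr_const card_ord.
by rewrite -[p0 *+ n]mulr_natl lerD2r ler_wpM2r.
Qed.

Theorem theorem2p2 (R : realType)
    (a K M : R) (L : R -> R)
    (ha : 0 < a) (hK : 0 < K)
    (hLsv : slowly_varying L)
    (hLnd : forall u v : R, 0 < u -> u <= v -> L u <= L v)
    (hLbd : forall u : R, 0 < u -> 0 < L u <= M)
    (hproper : (\int[lebesgue_measure]_(u in `]0%R, +oo[)
                  (local_prior a K L u)%:E = 1)%E)
    (sigma2 : forall n : nat, 'I_n -> R)
    (hsigma2 : forall (n : nat) (i : 'I_n), 0 < sigma2 n i)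
    (hsigma2O : (fun n : nat => \big[Num.max/0]_(i < n) sigma2 n i : R)
                  =O_\oo (fun _ : nat => 1 : R))
    (q eps tau Mn : nat -> R)
    (hq0 : forall n : nat, 0 < q n)
    (hqo : q =o_\oo (fun n : nat => n%:R : R))
    (hqa : a <= 4^-1 ->
             exists2 c : R, 0 < c & \forall n \near \oo, c <= q n)
    (heps : eps @ \oo --> (0 : R))
    (htau : forall n : nat,
        tau n = (q n / n%:R) `^ (1 + eps n) * ln (n%:R / q n))
    (hMn : Mn @ \oo --> +oo)
    (B : R) (hB : 0 <= B) :
  (fun n : nat =>
     ereal_sup
       [set (\sum_(i < n)
               gauss_prob (theta i) (sigma2 n i)
                 [set x : R | (Mn n * q n * ln (n%:R / q n)
                    < (bayes_estimator a K L (tau n) x - theta i) ^+ 2)%R])%E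
       | theta in @nearly_black R n (q n)
                  `&` [set theta | forall i : 'I_n, `|theta i| <= B]])
    @ \oo --> (0%E : \bar R).
Proof.
have L0 u : 0 < u -> 0 < L u by move=> /hLbd/andP[].
have [S S0 hS] : exists2 S : R, 0 < S &
    \forall n \near \oo, forall i : 'I_n, sigma2 n i <= S.
  have /eqO_exP[S S0 hS] := hsigma2O; exists S => //.
  near=> n; move=> i.
  have : `|\big[Num.max/0]_(i < n) sigma2 n i| <= S * `|(1 : R)| by near: n.
  rewrite normr1 mulr1; apply: le_trans; rewrite (le_trans _ (ler_norm _))//.
  exact: le_bigmax.
have hl : \forall n \near \oo, 1 <= ln (n%:R / q n).
  (* The constant [exp(-1)] is chosen because [q n <= n / e] says [ln (n / q n) >= 1]. *)
  have /eqoP/(_ (expR (-1)) (expR_gt0 _)) hq := hqo.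
  near=> n; have n0 : 0 < (n%:R : R) by rewrite ltr0n; near: n; exists 1%N.
  have : `|q n| <= expR (-1) * `|(n%:R : R)| by near: n.
  rewrite !gtr0_norm// expRN mulrC ler_pdivlMr ?expR_gt0// => qn.
  rewrite -ler_expR lnK ?posrE ?divr_gt0// ler_pdivlMr// mulrC//.
have hln : \forall n \near \oo, 1 <= ln (n%:R : R).
  near=> n; have n0 : 0 < (n%:R : R) by rewrite ltr0n; near: n; exists 1%N.
  rewrite -ler_expR lnK ?posrE//; near: n; exact: nbhs_infty_ger.
(* Both regimes give the same bound, uniform over variances up to [S], so [n] zero means contribute
   at most [C / Mn n]. *)
have [C C0 hC] : exists2 C : R, 0 <= C & \forall n \near \oo,
    forall v : R, 0 < v <= S ->
    (gauss_prob 0 v [set x | (Mn n * q n * ln (n%:R / q n) <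
        (bayes_estimator a K L (tau n) x - 0) ^+ 2)%R]
      <= (C / (n%:R * Mn n))%:E)%E.
  have [/hqa[c c0 hc]|a4] := leP a 4^-1.
    have [C [m0 [C0 hC]]] := zero_mean_tail_bounded_below c0 S0.
    exists C => //; near=> n; move=> v vS; apply: hC => //.
    - by move=> x; exact: posterior_shrinkage_itv01.
    - by rewrite ltr0n; near: n; exists 1%N.
    - by near: n.
    - by near: n.
    - by near: n.
    - by near: n; exact: cvgry_ge.
    - by near: n; exact: cvgry_gt.
  have [C [d [C0 d0 hC]]] := zero_mean_tail_gt4V a4 hK S0 hLnd hLbd hproper.
  exists C => //; near=> n; move=> v vS; rewrite htau; apply: hC => //.
  - by rewrite ltr0n; near: n; exists 1%N.
  - by near: n.
  - by near: n; exact: cvgr0_norm_le.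
  - by near: n; exact: cvgry_gt.
pose C1 := (16 * S + 6 * B ^+ 2) * Num.sqrt 2.
have C10 : 0 <= C1.
  by rewrite mulr_ge0// addr_ge0// mulr_ge0 ?sqr_ge0// ltW.
apply: (@squeeze_cvge _ _ _ _ (cst 0%E) _ (fun n => ((C1 + C) * (Mn n)^-1)%:E)).
- near=> n; have Mn0 : 0 < Mn n by near: n; exact: cvgry_gt.
  have n0 : 0 < (n%:R : R) by rewrite ltr0n; near: n; exists 1%N.
  have l1 : 1 <= ln (n%:R / q n) by near: n.
  have Sn : forall i : 'I_n, sigma2 n i <= S by near: n.
  have Cn : forall v : R, 0 < v <= S ->
    (gauss_prob 0 v [set x | (Mn n * q n * ln (n%:R / q n) <
        (bayes_estimator a K L (tau n) x - 0) ^+ 2)%R]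
      <= (C / (n%:R * Mn n))%:E)%E by near: n.
  apply/andP; split.
    (* The supremum of an empty set would be [-oo]; the zero vector lies in the set and makes the
       supremum nonnegative. *)
    pose t0 : 'I_n -> R := fun=> 0.
    apply: (@le_trans _ _ (\sum_(i < n) gauss_prob (t0 i) (sigma2 n i)
      [set x | (Mn n * q n * ln (n%:R / q n) <
        (bayes_estimator a K L (tau n) x - t0 i) ^+ 2)%R])%E).
      by apply: sume_ge0 => i _; apply: integral_ge0 => x _; rewrite lee_fin normal_pdf_ge0.
    apply: ereal_sup_ubound; exists t0 => //; split => /=.
      by rewrite /nearly_black/= big1 ?(ltW (hq0 n))// => i _; rewrite /t0 eqxx.
    by move=> i; rewrite /t0 normr0.
  apply: ge_ereal_sup => _ [theta [tq tB] <-].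
  set T := Mn n * q n * ln _.
  have T0 : 0 < T by rewrite !mulr_gt0//; lra.
  apply: le_trans (@sparse_sum_le _ _ theta (q n) (C1 / T) (C / (n%:R * Mn n)) _ tq _ _ _ _) _.
  + by rewrite divr_ge0// ltW.
  + by rewrite divr_ge0// mulr_ge0// ltW.
  + move=> i _; rewrite /C1 mulrAC; apply: gauss_prob_shrunk_le => //.
      by move=> x; exact: posterior_shrinkage_itv01.
    by rewrite hsigma2 Sn.
  + by move=> i ->; apply: Cn; rewrite hsigma2 Sn.
  rewrite lee_fin mulrDl; apply: lerD; last first.
    by rewrite le_eqVlt; apply/orP; left; apply/eqP; field; rewrite !gt_eqF.
  (* In the contribution of the nonzero means [q n] cancels, and the remaining logarithm is at least
     1. *)
  rewrite [leLHS](_ : _ = C1 / Mn n * (ln (n%:R / q n))^-1); last first.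
    by rewrite /T; field; rewrite !gt_eqF//; lra.
  by rewrite ler_piMr ?divr_ge0 ?(ltW Mn0)// invf_le1//; lra.
- exact: cvg_cst.
- apply: cvg_EFin; first exact: nearW.
  rewrite -(mulr0 (C1 + C)); apply: cvgMl_tmp.
  by apply/gtr0_cvgV0 => //; exact: cvgry_gt.
Unshelve. all: by end_near. Qed.
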